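(* Let $n$ be a positive integer and let $\frac{c}{d}$ be an irreducible fraction with $0<\frac{c}{d}<1$ and $\frac{c}{d}\neq\frac12$. Let $\mathcal{A},\mathcal{B}\subseteq 2^{[n]}$. Then $(\mathcal{A},\mathcal{B})$ is a maximal $\frac{c}{d}$-cross-intersecting pair of $2^{[n]}$ if and only if $\mathcal{A}=2^{[n]}$ and $\mathcal{B}=\{\emptyset\}$.
   Context: Here $[n]=\{1,2,\dots,n\}$ and $2^{[n]}$ is the power set of $[n]$. For an irreducible fraction $\frac{c}{d}\in[0,1]$, a pair $(\mathcal{A},\mathcal{B})$ of families $\mathcal{A},\mathcal{B}\subseteq 2^{[n]}$ is called a $\frac{c}{d}$-cross-intersecting pair of $2^{[n]}$ if $|A\cap B|=\frac{c}{d}|B|$ for every $A\in\mathcal{A}$ and $B\in\mathcal{B}$. Let $\mathcal{M}_{\frac{c}{d}}(n)$ be the maximum of $|\mathcal{A}||\mathcal{B}|$ over all $\frac{c}{d}$-cross-intersecting pairs $(\mathcal{A},\mathcal{B})$ of $2^{[n]}$. A $\frac{c}{d}$-cross-intersecting pair $(\mathcal{A},\mathcal{B})$ of $2^{[n]}$ is called maximal if $|\mathcal{A}||\mathcal{B}|=\mathcal{M}_{\frac{c}{d}}(n)$. *)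

(* Defs.v *)
From mathcomp Require Import all_boot all_order all_algebra.

Set Implicit Arguments.
Unset Strict Implicit.
Unset Printing Implicit Defensive.

Definition cdfrac (c d : nat) : rat := (c%:R / d%:R)%R.

(* The ground set {1, ..., n} is modelled by the ordinals below n. *)
Definition cross_intersecting (c d n : nat) (FA FB : {set {set 'I_n}}) : bool :=
  [forall A in FA, forall B in FB,
    (#|A :&: B|%:R == cdfrac c d * #|B|%:R :> rat)%R].

Definition max_cross (c d n : nat) : nat :=
  \max_(F : {set {set 'I_n}} * {set {set 'I_n}} | cross_intersecting c d F.1 F.2)
    (#|F.1| * #|F.2|).

Definition maximal_cross_intersecting (c d n : nat)
    (FA FB : {set {set 'I_n}}) : bool :=
  cross_intersecting c d FA FB && (#|FA| * #|FB| == max_cross c d n).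

(* Main.v *)
Require Import Defs.
From mathcomp Require Import all_boot all_order all_algebra.
From mathcomp Require Import ring.

(** Write [t] for the fraction.  The condition #|A :&: B| = t * #|B| says that
    the row with entries [(i \in A) - t] is orthogonal to the indicator row
    of [B].  So if [V] is the span of the shifted rows of [FA] and [k] its
    dimension, the indicator rows of [FB] lie in the orthogonal complement of
    [V], which has dimension [n - k].

    A subspace of dimension [k] has [k] coordinates that determine all its
    vectors ([determining_coordinates]).  The rows coming from sets take two
    values at each coordinate, so a [k]-dimensional space contains at most
    [2 ^ k] of them ([leq_card_two_valued]).  Hence #|FA| <= 2 ^ k and
    #|FB| <= 2 ^ (n - k), and the product is at most [2 ^ n], which the pair of
    all sets and [[set set0]] attains.

    If the product equals [2 ^ n] then #|FA| = 2 ^ k, so every pattern on the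
    [k] determining coordinates comes from a member of [FA].  Comparing the
    members with empty and with full pattern shows that [set0 \in FA]
    ([set0_of_full_card]; this is where [t] must differ from [1 / 2]).  Then
    t * #|B| = #|set0 :&: B| = 0 for every [B] in [FB], so [FB] has at most
    the element [set0], and [FA] must consist of all sets. *)

Set Implicit Arguments.
Unset Strict Implicit.
Unset Printing Implicit Defensive.

Import Order.TTheory GRing.Theory Num.Theory.

Lemma card_set_ord n : #|{set 'I_n}| = 2 ^ n.
Proof. by rewrite -cardsT -powersetT card_powerset cardsT card_ord. Qed.

Section TwoValuedRows.

Local Open Scope ring_scope.

(** For [t = 0] this is the indicator row of [A], so the rows of both families
    of a pair are instances of it. *)
Definition shifted_row (F : fieldType) n (t : F) (A : {set 'I_n}) : 'rV[F]_n :=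
  \row_i ((i \in A)%:R - t).

Definition row_span (F : fieldType) n (t : F) (FA : {set {set 'I_n}}) :=
  \matrix_(r < #|FA|) shifted_row t (enum_val r).

Lemma shifted_row_span (F : fieldType) n (t : F) (FA : {set {set 'I_n}}) A :
  A \in FA -> (shifted_row t A <= row_span t FA)%MS.
Proof.
move=> AFA; rewrite -(enum_rankK_in AFA AFA).
by have := row_sub (enum_rank_in AFA A) (row_span t FA); rewrite rowK.
Qed.

(** The columns selected by [f] from a row basis of [V] form an invertible
    matrix, so the coefficients of [v] on that basis, hence [v] itself, can be
    read off from the coordinates in the image of [f]. *)
Lemma determining_coordinates (F : fieldType) m n (V : 'M[F]_(m, n)) :
  exists f : 'I_(\rank V) -> 'I_n,
    forall v : 'rV_n, (v <= V)%MS -> (forall i, v 0 (f i) = 0) -> v = 0.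
Proof.
have full_base : row_full (row_base V)^T.
  by rewrite /row_full mxrank_tr; apply: row_base_free.
exists (fullrankfun full_base) => v; rewrite -(eq_row_base V).
case/submxP=> u -> {v} uf0.
suff -> : u = 0 by rewrite mul0mx.
apply: trmx_inj; rewrite trmx0 -(mulKmx (fullrowsub_unit full_base) u^T).
set C := rowsub _ _; suff -> : C *m u^T = 0 by rewrite mulmx0.
rewrite mul_rowsub_mx -trmx_mul.
by apply/matrixP=> i j; rewrite [LHS]mxE [LHS]mxE ord1 uf0 mxE.
Qed.

Section DeterminingCoordinates.

Variables (F : fieldType) (m n k : nat) (V : 'M[F]_(m, n)).
Variables (f : 'I_k -> 'I_n) (t : F) (FA : {set {set 'I_n}}).
Hypothesis f_determines :
  forall v : 'rV_n, (v <= V)%MS -> (forall i, v 0 (f i) = 0) -> v = 0.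
Hypothesis FA_in_V : {in FA, forall A, (shifted_row t A <= V)%MS}.

(** The entries [1 - t] and [- t] differ, so the row of [A] determines [A], and
    [f] determines the row. *)
Lemma pattern_inj : {in FA &, injective (fun A : {set 'I_n} => f @^-1: A)}.
Proof.
move=> A B AFA BFA /setP eqAB; apply/setP=> i.
have: shifted_row t A - shifted_row t B = 0.
  apply: f_determines => [|j].
    by rewrite addmx_sub ?eqmx_opp ?FA_in_V.
  by have := eqAB j; rewrite !inE !mxE => ->; rewrite subrr.
move/rowP/(_ i); rewrite !mxE opprB addrA subrK => /eqP; rewrite subr_eq0.
by case: (i \in A) (i \in B) => [] [] //; rewrite ?(eq_sym 0) oner_eq0.
Qed.

Lemma leq_card_patterns : (#|FA| <= 2 ^ k)%N.
Proof.
by rewrite -(card_in_imset pattern_inj) -card_set_ord max_card.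
Qed.

Lemma pattern_surj (I : {set 'I_k}) :
  #|FA| = (2 ^ k)%N -> exists2 A, A \in FA & f @^-1: A = I.
Proof.
move=> cardFA.
suff: I \in [set f @^-1: (A : {set 'I_n}) | A in FA].
  by case/imsetP=> A AFA ->; exists A.
suff /eqP-> : [set f @^-1: (A : {set 'I_n}) | A in FA] == setT.
  by rewrite inE.
rewrite eqEcard subsetT cardsT card_set_ord (card_in_imset pattern_inj).
by rewrite cardFA leqnn.
Qed.

(** If [A0] has empty and [A1] full pattern, then (1 - t) times the row of [A0]
    plus [t] times the row of [A1] vanishes on the image of [f], hence
    everywhere.  At a point [i] of [A0] this reads
    (1 - t) ^ 2 + t * ((i \in A1) - t) = 0.  The left side is [1 - t] if
    [i \in A1] and [1 - 2 * t] otherwise. *)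
Lemma set0_of_full_patterns :
  t != 1 -> t *+ 2 != 1 -> #|FA| = (2 ^ k)%N -> set0 \in FA.
Proof.
move=> t_neq1 t2_neq1 cardFA.
have [A0 A0FA pA0] := pattern_surj set0 cardFA.
have [A1 A1FA pA1] := pattern_surj setT cardFA.
suff <- : A0 = set0 by [].
have /rowP comb0 : (1 - t) *: shifted_row t A0 + t *: shifted_row t A1 = 0.
  apply: f_determines => [|j].
    by rewrite addmx_sub ?scalemx_sub ?FA_in_V.
  have /setP/(_ j) := pA0; have /setP/(_ j) := pA1.
  by rewrite !inE !mxE => -> -> /=; ring.
apply/setP=> i; rewrite inE; apply/negP=> iA0.
have := comb0 i; rewrite !mxE iA0; case: (i \in A1) => /= eq0.
- by case/eqP: t_neq1; apply/eqP; rewrite eq_sym -subr_eq0 -eq0; apply/eqP; ring.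
- by case/eqP: t2_neq1; apply/eqP; rewrite eq_sym -subr_eq0 -eq0; apply/eqP; ring.
Qed.

End DeterminingCoordinates.

Lemma leq_card_two_valued (F : fieldType) m n (V : 'M[F]_(m, n)) (t : F)
    (FA : {set {set 'I_n}}) :
  {in FA, forall A, (shifted_row t A <= V)%MS} -> (#|FA| <= 2 ^ \rank V)%N.
Proof.
by have [f f_det] := determining_coordinates V; apply: leq_card_patterns f_det.
Qed.

Lemma set0_of_full_card (F : fieldType) m n (V : 'M[F]_(m, n)) (t : F)
    (FA : {set {set 'I_n}}) :
  {in FA, forall A, (shifted_row t A <= V)%MS} ->
  t != 1 -> t *+ 2 != 1 -> #|FA| = (2 ^ \rank V)%N -> set0 \in FA.
Proof.
have [f f_det] := determining_coordinates V.
exact: set0_of_full_patterns f_det.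
Qed.

Lemma shifted_row_dot (F : fieldType) n (t : F) (A B : {set 'I_n}) :
  shifted_row t A *m (shifted_row 0 B)^T = (#|A :&: B|%:R - t * #|B|%:R)%:M.
Proof.
apply/rowP=> i; rewrite ord1 !mxE eqxx mulr1n -!sum1_card !natr_sum mulr_sumr.
rewrite [X in X - _]big_mkcond [X in _ - X]big_mkcond -sumrB.
apply: eq_bigr => j _; rewrite !mxE inE.
by case: (j \in A); case: (j \in B) => /=; ring.
Qed.

End TwoValuedRows.

Section CrossIntersecting.

Variables (n c d : nat).
Implicit Types FA FB : {set {set 'I_n}}.

Let t : rat := cdfrac c d.

Lemma cross_intersectingP FA FB :
  reflect {in FA & FB, forall A B, #|A :&: B|%:R = t * #|B|%:R}%R
          (cross_intersecting c d FA FB).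
Proof.
apply: (iffP forall_inP) => [cross A B AFA BFB | cross A AFA].
  by apply/eqP; move/forall_inP: (cross A AFA); apply.
by apply/forall_inP=> B BFB; apply/eqP; apply: cross.
Qed.

Lemma indicator_rows_orthogonal FA FB :
  cross_intersecting c d FA FB ->
  {in FB, forall B, (shifted_row 0 B <= kermx (row_span t FA)^T)%MS}.
Proof.
move/cross_intersectingP=> cross B BFB; apply/sub_kermxP; apply: trmx_inj.
rewrite trmx_mul trmxK trmx0; apply/row_matrixP=> r.
rewrite row_mul rowK shifted_row_dot cross ?enum_valP // subrr row0.
by apply/rowP=> i; rewrite !mxE mul0rn.
Qed.

Lemma leq_card_cross_r FA FB :
  cross_intersecting c d FA FB -> #|FB| <= 2 ^ (n - \rank (row_span t FA)).
Proof.
move=> /indicator_rows_orthogonal/leq_card_two_valued.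
by rewrite mxrank_ker mxrank_tr.
Qed.

Lemma leq_card_cross_l FA : #|FA| <= 2 ^ \rank (row_span t FA).
Proof. exact: leq_card_two_valued (@shifted_row_span _ _ _ _). Qed.

Lemma expn_rank_row_span FA :
  2 ^ \rank (row_span t FA) * 2 ^ (n - \rank (row_span t FA)) = 2 ^ n.
Proof. by rewrite -expnD subnKC ?rank_leq_col. Qed.

Lemma cross_intersecting_set0 FA : cross_intersecting c d FA [set set0].
Proof.
apply/cross_intersectingP=> A B _; rewrite inE => /eqP->.
by rewrite setI0 cards0 mulr0.
Qed.

Lemma max_crossE : max_cross c d n = 2 ^ n.
Proof.
apply/eqP; rewrite eqn_leq; apply/andP; split.
  apply/bigmax_leqP=> -[FA FB] /= cross.
  by rewrite -(expn_rank_row_span FA) leq_mul ?leq_card_cross_l ?leq_card_cross_r.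
apply: leq_trans (leq_bigmax_cond (setT, _) (cross_intersecting_set0 setT)).
by rewrite /= cards1 muln1 cardsT card_set_ord.
Qed.

End CrossIntersecting.

Theorem theorem1p5 (n c d : nat) (FA FB : {set {set 'I_n}})
    (n_gt0 : 0 < n) (d_gt0 : 0 < d) (irreducible_cd : coprime c d)
    (frac_gt0 : (0 < cdfrac c d)%R) (frac_lt1 : (cdfrac c d < 1)%R)
    (frac_neq_half : cdfrac c d <> (1 / 2%:R)%R) :
  maximal_cross_intersecting c d FA FB <->
  FA = [set: {set 'I_n}] /\ FB = [set set0].
Proof.
rewrite /maximal_cross_intersecting max_crossE; split; last first.
  case=> -> ->; rewrite cards1 muln1 cardsT card_set_ord eqxx andbT.
  exact: cross_intersecting_set0.
case/andP=> cross /eqP card_prod.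
set V := row_span (cdfrac c d) FA.
(* Since #|FB| <= 2 ^ (n - \rank V), a smaller [FA] could not reach 2 ^ n. *)
have cardFA : #|FA| = 2 ^ \rank V.
  apply/eqP; rewrite eqn_leq leq_card_cross_l /=.
  rewrite -(leq_pmul2r (expn_gt0 2 (n - \rank V))).
  rewrite expn_rank_row_span -card_prod leq_mul2l.
  by rewrite leq_card_cross_r ?orbT.
have FA0 : set0 \in FA.
  apply: set0_of_full_card (@shifted_row_span _ _ _ _) _ _ cardFA.
  - by rewrite lt_eqF.
  - apply/eqP=> t2; apply: frac_neq_half.
    by apply: (canRL (mulfK _)); rewrite ?mulr_natr ?pnatr_eq0.
have FB_sub : FB \subset [set set0].
  apply/subsetP=> B BFB; rewrite inE -cards_eq0.
  have /eqP := cross_intersectingP _ _ _ _ cross _ _ FA0 BFB.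
  by rewrite set0I cards0 eq_sym mulf_eq0 gt_eqF //= pnatr_eq0.
have cardFB : #|FB| <= 1 by rewrite -(cards1 (set0 : {set 'I_n})) subset_leq_card.
split.
- apply/eqP; rewrite eqEcard subsetT cardsT card_set_ord -card_prod.
  by rewrite -{2}[#|FA|]muln1 leq_mul2l cardFB orbT.
- apply/eqP; rewrite eqEcard FB_sub cards1 lt0n.
  by apply/eqP=> FB0; move: card_prod; rewrite FB0 muln0 => /esym/eqP; rewrite expn_eq0.
Qed.
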